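(* Let $n\ge 2$ and $0\le j\le n$, and let $\mathcal{T}_n$ be the arrangement of hyperplanes $\{x_i+x_j=0\mid 1\le i<j\le n\}$ in $\mathbb{R}^n$. The absolute value of the coefficient of $t^j$ in the characteristic polynomial $\chi_{\mathcal{T}_n}(t)$ equals the number of threshold permutations of size $n$ with exactly $j$ odd cycles.
   Context: For a hyperplane arrangement $\mathcal{A}$ in $\mathbb{R}^n$, $\chi_{\mathcal{A}}(t)=\sum_{x\in L(\mathcal{A})}\mu(\hat 0,x)\,t^{\dim x}$, where $L(\mathcal{A})$ is the poset of nonempty intersections of hyperplanes ordered by reverse inclusion, $\hat 0=\mathbb{R}^n$, and $\mu$ its Möbius function. A signed permutation of $[n]$ is a permutation $\pi_1\cdots\pi_n$ of $[n]$ with a sign $w_i\in\{+,-\}$ assigned to each $\pi_i$. A threshold permutation of size $n$ is a signed permutation of $[n]$ such that: (1) $\pi_1<\pi_2$; (2) if $\pi_1=1$ then $w_1=-$; (3) if $\pi_1\ne 1$ then $w_2=-$; (4) for every $i\ge 2$ with $w_i=+$ we have $\pi_i>\pi_{i-1}$. Compartments of a signed permutation: draw a line before $\pi_1$; then repeatedly draw a line immediately after the least entry located after the last line drawn, until a line is drawn after $\pi_n$; the segments between consecutive lines are the compartments. An odd cycle is a compartment containing an odd number of entries with sign $-$. *)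

(* Defs.v *)
From HB Require Import structures.
From mathcomp Require Import all_boot all_order all_algebra all_fingroup.
From mathcomp Require Import finmap.
From mathcomp Require Import reals.

Set Implicit Arguments.
Unset Strict Implicit.
Unset Printing Implicit Defensive.

Import Order.TTheory GRing.Theory Num.Theory.

Local Open Scope fset_scope.
Local Open Scope ring_scope.

(* Möbius function of the finite poset P ordered by le.  The recursion runs on
   fuel; #|` P| bounds the length of every chain of P, so mobius satisfies the
   usual recurrence (mobiusE). *)
Fixpoint mobius_rec (T : choiceType) (le : rel T) (P : {fset T})
    (k : nat) (x y : T) : int :=
  if k is k'.+1 then
    if x == y then 1
    else - \sum_(z <- P | [&& le x z, le z y & z != y]) mobius_rec le P k' x z
  else 0.

Definition mobius (T : choiceType) (le : rel T) (P : {fset T}) (x y : T) : int :=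
  mobius_rec le P #|` P| x y.

Lemma mobius_rec_stable (T : choiceType) (le : rel T) (P : {fset T})
    (k l : nat) (x y : T) :
  reflexive le -> transitive le -> antisymmetric le -> y \in P ->
  (#|` [fset z in P | le z y]| <= k)%N -> (#|` [fset z in P | le z y]| <= l)%N ->
  mobius_rec le P k x y = mobius_rec le P l x y.
Proof.
move=> le_refl le_tr le_anti.
have pos u : u \in P -> (0 < #|` [fset z in P | le z u]|)%N.
  by move=> uP; rewrite cardfs_gt0; apply/fset0Pn; exists u; rewrite !inE /= uP /=.
elim: k l y => [|k IHk] [|l] y yP; rewrite ?leqn0 //;
  try by have := pos y yP; case: (#|` _|).
move=> hk hl /=; case: eqP => // _; congr (- _).
rewrite big_seq_cond [in RHS]big_seq_cond; apply: eq_bigr => z /and4P[zP _ zy zNy].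
have lt_zy : (#|` [fset u in P | le u z]| < #|` [fset u in P | le u y]|)%N.
  apply: fproper_ltn_card; rewrite fproperE; apply/andP; split.
    apply/fsubsetP => u; rewrite !inE /= => /andP[-> uz] /=.
    exact: le_tr uz zy.
  apply: contra zNy => /fsubsetP/(_ y); rewrite !inE /= yP le_refl => /(_ isT) yz.
  by apply/eqP/le_anti; rewrite zy.
by apply: IHk => //; rewrite -ltnS; apply: leq_trans lt_zy _.
Qed.

Lemma mobiusE (T : choiceType) (le : rel T) (P : {fset T}) (x y : T) :
  reflexive le -> transitive le -> antisymmetric le -> y \in P ->
  mobius le P x y =
    if x == y then 1
    else - \sum_(z <- P | [&& le x z, le z y & z != y]) mobius le P x z.
Proof.
move=> le_refl le_tr le_anti yP.
have sub u : (#|` [fset z in P | le z u]| <= #|` P|)%N.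
  by apply: fsubset_leq_card; apply/fsubsetP => z; rewrite !inE => /andP[].
rewrite /mobius (@mobius_rec_stable _ _ _ _ #|` P|.+1) //=; last exact: leqW.
Qed.

(* Linear (central) arrangements only: every intersection contains 0, so the
   nonemptiness of the intersections is automatic. *)
Definition arrangement (F : fieldType) (n : nat) := {fset {vspace 'rV[F]_n}}.

(* B = fset0 contributes the whole space. *)
Definition intersection_poset (F : fieldType) (n : nat) (A : arrangement F n) :
    {fset {vspace 'rV[F]_n}} :=
  [fset (\bigcap_(H <- (B : arrangement F n)) H)%VS | B in fpowerset A].

Definition reverse_inclusion (F : fieldType) (n : nat) :
    rel {vspace 'rV[F]_n} :=
  fun X Y => (Y <= X)%VS.

Definition arr_char_poly (F : fieldType) (n : nat) (A : arrangement F n) :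
    {poly int} :=
  \sum_(X <- intersection_poset A)
    mobius (@reverse_inclusion F n) (intersection_poset A) fullv X
      *: 'X^(\dim X).

Definition sum_hyperplane (F : fieldType) (n : nat) (i j : 'I_n) :
    {vspace 'rV[F]_n} :=
  lker (linfun (fun x : 'rV[F]_n => x 0 i + x 0 j : F^o)).

Lemma mem_sum_hyperplane (F : fieldType) (n : nat) (i j : 'I_n) (x : 'rV[F]_n) :
  (x \in sum_hyperplane F i j) = (x 0 i + x 0 j == 0).
Proof.
pose f := fun x : 'rV[F]_n => x 0 i + x 0 j : F^o.
have fP : linear f.
  by move=> a u v; rewrite /f !mxE scalerDr addrACA.
pose fM := GRing.isLinear.Build _ _ _ _ f fP.
pose fL : {linear 'rV[F]_n -> F^o} := HB.pack f fM.
by rewrite memv_ker -[X in linfun X]/(fL : _ -> _) lfunE.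
Qed.

Definition threshold_arrangement (F : fieldType) (n : nat) : arrangement F n :=
  [fset sum_hyperplane F p.1 p.2 | p in [set p : 'I_n * 'I_n | (p.1 < p.2)%N]].

(* (pi, w): pi i is the entry in position i and w i its sign, true being -.
   Both positions and entries are shifted by one to fit in 'I_n. *)
Definition signed_perm (n : nat) : finType := ({perm 'I_n} * {ffun 'I_n -> bool})%type.

(* The word of pairs (pi_i, w_i), with entries back in {1, ..., n}; the letter
   of index i (from 0) in the word is the one in position i + 1. *)
Definition signed_word (n : nat) (s : signed_perm n) : seq (nat * bool) :=
  [seq ((s.1 i : nat).+1, s.2 i) | i <- enum 'I_n].

Definition entry (u : seq (nat * bool)) (i : nat) : nat := (nth (0%N, false) u i).1.

Definition neg (u : seq (nat * bool)) (i : nat) : bool := (nth (0%N, false) u i).2.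

Definition is_threshold (n : nat) (s : signed_perm n) : bool :=
  let u := signed_word s in
  [&& (entry u 0 < entry u 1)%N,
      (entry u 0 == 1%N) ==> neg u 0,
      (entry u 0 != 1%N) ==> neg u 1
    & [forall i : 'I_n, (0 < i)%N && ~~ neg u i ==> (entry u i.-1 < entry u i)%N]].

Definition least_index (u : seq (nat * bool)) : nat :=
  find (fun a => all (fun b => (a.1 <= b.1)%N) u) u.

Fixpoint compartments_rec (k : nat) (u : seq (nat * bool)) :
    seq (seq (nat * bool)) :=
  match k, u with
  | k'.+1, _ :: _ =>
      let c := (least_index u).+1 in
      take c u :: compartments_rec k' (drop c u)
  | _, _ => [::]
  end.

Definition compartments (u : seq (nat * bool)) : seq (seq (nat * bool)) :=
  compartments_rec (size u) u.

Lemma flatten_compartments (u : seq (nat * bool)) : flatten (compartments u) = u.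
Proof.
have flatten_rec k v : (size v <= k)%N -> flatten (compartments_rec k v) = v.
  elim: k v => [|k IHk] [|a v] // hv.
  rewrite [compartments_rec _ _]/= [flatten _]/= IHk ?cat_take_drop //.
  by rewrite size_drop (leq_trans (leq_subr _ _)).
exact: flatten_rec.
Qed.

Definition odd_cycle (c : seq (nat * bool)) : bool := odd (count snd c).

Definition num_odd_cycles (n : nat) (s : signed_perm n) : nat :=
  count odd_cycle (compartments (signed_word s)).

(* Main.v *)
(** Both sides are compared through the polynomials defined by
    [p_0(y) = 1] and [p_(n+1)(y) = y (p_n(y) + p_n(y+1))].

    Let [T_n(t)] be the sum of [t^(number of odd cycles)] over threshold
    permutations.  For a fixed permutation the signs can be summed out: reading the
    word from the right, a new first letter contributes the factor [t + 1] if it is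
    a minimum, [2] if it is an ascent and [1] if it is a descent, and the conditions
    on the first two letters lower the last such factor by one.  Sorting
    permutations by the rank of their first letter gives
    [T_n(2y - 1) = p_n(y) - n p_(n-1)(y)].

    On the other side, every flat [X] of the arrangement meets the grid
    [{-m, ..., m}^n] in [(2m + 1)^(dim X)] points, so the finite field method works
    over the reals: [chi(2m + 1)] counts the grid points on no hyperplane, which
    gives [(-1)^n (p_n(-m) - n p_(n-1)(-m))].  Hence [chi(t) = (-1)^n T_n(-t)] for
    every odd positive [t]. *)
Require Import Defs.
From mathcomp Require Import all_boot all_order all_algebra all_fingroup.
From mathcomp Require Import finmap.
From mathcomp Require Import reals.
From mathcomp Require Import zify ring.

Import Order.TTheory GRing.Theory Num.Theory.

Local Open Scope ring_scope.

(** * Compartments and signs *)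

Lemma compartments_rec_fuel k u : (size u <= k)%N ->
  compartments_rec k u = compartments u.
Proof.
rewrite /compartments; have [l] := ubnP (size u).
elim: l k u => // l IHl [|k] [|a u] //= hl hk; congr (_ :: _).
have hd : (size (drop (least_index (a :: u)).+1 (a :: u)) <= size u)%N.
  by rewrite size_drop /= subSS leq_subr.
by rewrite !IHl // (leq_ltn_trans hd, leq_trans hd).
Qed.

Lemma least_index_cons c v :
  least_index (c :: v) =
    if all (fun b => c.1 <= b.1)%N v then 0%N else (least_index v).+1.
Proof.
rewrite {1}/least_index /= leqnn /=; case: ifPn => // nmin; congr _.+1.
apply: eq_in_find => a av /=; case: leqP => //= lca; apply/esym/negbTE.
apply: contra nmin => /allP lav; apply/allP => b /lav.
exact: leq_trans (ltnW lca).
Qed.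

(** A new first letter that is a minimum is cut off at once; otherwise the least entry is still that
    of [v], and the letter joins the first compartment. Hence words are read from the right. *)
Lemma compartments_cons c v :
  let C := compartments v in
  compartments (c :: v) =
    if all (fun b => c.1 <= b.1)%N v then [:: c] :: C
    else (c :: head [::] C) :: behead C.
Proof.
rewrite /= {1}/compartments [size _]/= [compartments_rec _ _]/= least_index_cons.
case: ifPn => [_|]; first by rewrite take0 drop0.
case: v => // d v _; rewrite [RHS]/=.
have sz : (size (drop (least_index (d :: v)) v) <= size v)%N.
  by rewrite size_drop leq_subr.
rewrite [drop _ _]/= !compartments_rec_fuel //; exact: leqW.
Qed.

Local Arguments compartments : simpl never.

Section SignedWords.

Variable t : int.

Definition odd_cycles v := count odd_cycle (compartments v).

Definition admissible (a b : nat * bool) := b.2 || (a.1 < b.1)%N.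

Fixpoint signings (u : seq nat) : seq (seq (nat * bool)) :=
  if u is a :: u' then [seq (a, s) :: v | s <- [:: true; false], v <- signings u']
  else [:: [::]].

Lemma mem_signings u v : (v \in signings u) = (unzip1 v == u).
Proof.
elim: u v => [|a u IHu] v; first by case: v.
apply/allpairsP/eqP => [[[s w] /= [_]]|]; first by rewrite IHu => /eqP <- ->.
case: v => // [[b s] v] /= [-> vE]; exists (s, v); split=> //=.
  by case: s.
by rewrite IHu vE.
Qed.

Lemma uniq_signings u : uniq (signings u).
Proof.
elim: u => //= a u IHu; rewrite cats0 cat_uniq !map_inj_uniq ?IHu ?andbT //=.
- by apply/hasPn => x /mapP[v _ ->]; apply/mapP => -[].
- by move=> ? ? [].
- by move=> ? ? [].
Qed.

Lemma big_signings_cons (G : seq (nat * bool) -> int) a u :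
  \sum_(v <- signings (a :: u)) G v =
    \sum_(v <- signings u) G ((a, true) :: v)
    + \sum_(v <- signings u) G ((a, false) :: v).
Proof. by rewrite /= cats0 big_cat !big_map. Qed.

Lemma behead_compartments_sign a s v :
  behead (compartments ((a, s) :: v)) = behead (compartments ((a, true) :: v)).
Proof. by rewrite !compartments_cons; case: ifP. Qed.

(* The sign of the head only affects the parity of the first compartment. *)
Lemma odd_cycles_sign_sum a v :
  t ^+ odd_cycles ((a, true) :: v) + t ^+ odd_cycles ((a, false) :: v) =
    (t + 1) * t ^+ count odd_cycle (behead (compartments ((a, true) :: v))).
Proof.
rewrite /odd_cycles !compartments_cons /=; case: ifP => _ /=.
  by rewrite add1n exprS mulrDl mul1r.
rewrite /odd_cycle /=; case: (odd _) => /=; rewrite ?add0n ?add1n exprS; ring.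
Qed.

(** The default of [head] is harmless: it is only consulted when [a] is not a minimum, so that [u']
    is nonempty. *)
Fixpoint weight (u : seq nat) : int :=
  if u is a :: u' then
    (if all (leq a) u' then t + 1 else if (a < head 0 u')%N then 2 else 1)
      * weight u'
  else 1.

Lemma weight_cons a u :
  weight (a :: u) =
    (if all (leq a) u then t + 1 else if (a < head 0 u)%N then 2 else 1) * weight u.
Proof. by []. Qed.

(** The letter [a] joins the compartment of [b]. Whatever [s] is, the two signs of [a] give that
    compartment each parity once, as the two signs of [b] do without [a]. *)
Lemma odd_cycles_absorb a b s v : ~~ all (leq a) (b :: unzip1 v) ->
  t ^+ odd_cycles [:: (a, true), (b, s) & v]
    + t ^+ odd_cycles [:: (a, false), (b, s) & v]
  = t ^+ odd_cycles ((b, true) :: v) + t ^+ odd_cycles ((b, false) :: v).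
Proof.
move=> nmin; rewrite !odd_cycles_sign_sum compartments_cons.
have -> : all (fun c => a <= c.1)%N ((b, s) :: v) = false.
  by apply/negbTE; move: nmin; rewrite /= all_map.
by rewrite -(behead_compartments_sign b s v).
Qed.

Lemma path_admissible_sign a s v :
  path admissible (a, s) v = path admissible (a, true) v.
Proof. by case: v. Qed.

Lemma sorted_admissible_min a s v : uniq (a :: unzip1 v) -> all (leq a) (unzip1 v) ->
  sorted admissible ((a, s) :: v) = sorted admissible v.
Proof.
case: v => //= b v; rewrite inE negb_or => /andP[/andP[neq_ab _] _] /andP[le_ab _].
by rewrite /admissible ltn_neqAle neq_ab le_ab orbT.
Qed.

Lemma odd_cycles_min a s v : all (leq a) (unzip1 v) ->
  odd_cycles ((a, s) :: v) = (s + odd_cycles v)%N.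
Proof.
rewrite all_map /odd_cycles compartments_cons => amin.
by rewrite ifT //= /odd_cycle /= addn0; case: s.
Qed.

(** A minimum is a compartment by itself and gives [t] or [1] according to its sign. Any other
    letter is absorbed, and its factor counts the signs left to the next letter: both at an ascent,
    only minus at a descent. *)
Lemma weight_signings u : uniq u ->
  \sum_(v <- signings u | sorted admissible v) t ^+ odd_cycles v = weight u.
Proof.
elim: u => [|a u IHu]; first by rewrite big_mkcond /= big_seq1.
move=> uau; have uu : uniq u by case/andP: uau.
rewrite big_mkcond big_signings_cons [RHS]/= -IHu //.
case: ifPn => amin.
  rewrite [X in _ = _ * X]big_mkcond !big_seq -big_split mulr_sumr.
  apply: eq_bigr => v; rewrite mem_signings => /eqP vE.
  rewrite !sorted_admissible_min ?vE //; case: ifP => _ /=; last by ring.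
  by rewrite !odd_cycles_min ?vE // add1n add0n exprS /=; ring.
case: u amin {IHu uau} uu => // b u nmin _.
rewrite !(big_signings_cons _ b u) [in RHS]big_mkcond.
rewrite (big_signings_cons _ b u) -!big_split mulr_sumr !big_seq.
apply: eq_bigr => v; rewrite mem_signings => /eqP vE /=.
rewrite !path_admissible_sign /admissible /= -/admissible.
have oc_sum s := @odd_cycles_absorb a b s v; rewrite vE in oc_sum.
have [h1 h2] := (oc_sum true nmin, oc_sum false nmin).
case: (path _ _ _); rewrite ?andbF /= ?addr0 ?mulr0 //.
rewrite andbT; case: ifP => _; first by rewrite addrACA h1 h2; ring.
by rewrite !addr0 mul1r.
Qed.

Definition threshold_word (v : seq (nat * bool)) :=
  [&& (entry v 0 < entry v 1)%N, (entry v 0 == 1%N) ==> neg v 0,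
      (entry v 0 != 1%N) ==> neg v 1 & sorted admissible v].

(** A first letter that is a minimum is forced to be negative: its factor drops from [t + 1] to [t].
    Otherwise an ascent and a negative second letter are forced: the factor drops from [2] to [1] at
    an ascent and from [1] to [0] at a descent. *)
Lemma weight_threshold_signings a u :
  uniq (a :: u) -> u != [::] -> (a == 1%N) = all (leq a) u ->
  \sum_(v <- signings (a :: u) | threshold_word v) t ^+ odd_cycles v
    = weight (a :: u) - weight u.
Proof.
move=> uau u0 a1; have uu : uniq u by case/andP: uau.
rewrite big_mkcond big_signings_cons [weight (a :: u)]/=.
case: ifPn => amin.
  rewrite mulrDl mul1r addrK -weight_signings //.
  rewrite [X in _ + X]big1_seq ?addr0; last first.
    by move=> v _; rewrite /threshold_word /entry /neg /= a1 amin andbF.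
  rewrite [in RHS]big_mkcond mulr_sumr !big_seq.
  apply: eq_bigr => v; rewrite mem_signings => /eqP vE.
  rewrite /threshold_word sorted_admissible_min ?vE // odd_cycles_min ?vE //.
  rewrite /entry /neg /= a1 amin /= add1n exprS.
  have -> : (a < (nth (0%N, false) v 0).1)%N.
    case: v vE => [|b v] vE; first by rewrite -vE in u0.
    have := uau; rewrite -vE /= inE negb_or => /andP[/andP[nab _] _].
    by rewrite ltn_neqAle nab (allP amin) // -vE mem_head.
  by rewrite /=; case: (sorted _ _); rewrite ?mulr0.
case: u {u0} amin a1 uu {uau} => // b u nmin a1 ubu.
rewrite !(big_signings_cons _ b u) [head _ _]/=.
(* The weight of [b :: u] becomes a sum over the signings of [u] alone, with the two signs of [b]
   side by side, the shape that [odd_cycles_absorb] produces. *)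
rewrite [X in _ = _ * X - X](_ : _ = \sum_(v <- signings u)
  if path admissible (b, true) v then
    t ^+ odd_cycles ((b, true) :: v) + t ^+ odd_cycles ((b, false) :: v)
  else 0); last first.
  rewrite -weight_signings // big_mkcond big_signings_cons -big_split.
  apply: eq_bigr => v _ /=; rewrite path_admissible_sign.
  by case: ifP; rewrite ?addr0.
rewrite -!big_split /= mulr_sumr -sumrB !big_seq.
apply: eq_bigr => v; rewrite mem_signings => /eqP vE /=.
rewrite /threshold_word /entry /neg /= a1 (negbTE nmin) /= !andbF /=.
rewrite !addr0 /admissible /= -/admissible.
have := @odd_cycles_absorb a b true v; rewrite vE => /(_ nmin) <-.
by case: ltnP => _ /=; case: ifP => _; ring.
Qed.

End SignedWords.

(** * Threshold permutations as signed words *)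

Lemma is_thresholdE n (s : signed_perm n) :
  is_threshold s = threshold_word (signed_word s).
Proof.
rewrite /is_threshold /threshold_word; congr [&& _, _, _ & _].
have sz : size (signed_word s) = n by rewrite size_map size_enum_ord.
apply/forallP/(sortedP (0%N, false)) => [h i|h i].
  rewrite sz => lin; have /implyP := h (Ordinal lin).
  by rewrite /admissible /entry /neg /=; case: (_.2) => //= ->.
apply/implyP => /andP[i0 ni]; have := h i.-1; rewrite prednK // sz ltn_ord.
by move=> /(_ isT); rewrite /admissible -/(neg _ i) (negbTE ni).
Qed.

Lemma signed_word_inj n : injective (@signed_word n).
Proof.
move=> [p w] [p' w'] /eq_in_map h; congr pair.
  by apply/permP => i; have [] := h i (mem_enum _ i) => /ord_inj.
by apply/ffunP => i; have [] := h i (mem_enum _ i).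
Qed.

Lemma perm_signed_words n :
  perm_eq [seq signed_word s | s : signed_perm n]
    [seq v | u <- permutations (iota 1 n), v <- signings u].
Proof.
apply: uniq_perm.
- by rewrite map_inj_uniq ?enum_uniq //; apply: signed_word_inj.
- apply: allpairs_uniq_dep => [|u _|]; rewrite ?permutations_uniq ?uniq_signings //.
  move=> [u v] [u' v'] /allpairsPdep[x [y [_]]]; rewrite mem_signings => /eqP yx.
  move=> [-> ->] /allpairsPdep[x' [y' [_]]]; rewrite mem_signings => /eqP yx'.
  by move=> [-> ->] /= yy; rewrite -yx -yx' yy.
move=> v; apply/mapP/allpairsPdep => [[s _ ->]|[u [w [hu]]]].
  exists (unzip1 (signed_word s)), (signed_word s); split => //.
    rewrite mem_permutations /signed_word /unzip1 -map_comp; apply: uniq_perm.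
    - by rewrite map_inj_uniq ?enum_uniq // => i j [] /ord_inj /perm_inj.
    - exact: iota_uniq.
    move=> k; rewrite mem_iota add1n ltnS; apply/mapP/idP => [[i _ -> /=]|].
      exact: ltn_ord.
    case: k => // k lkn; exists (s.1^-1 (Ordinal lkn))%g.
      exact: mem_enum.
    by rewrite /= permKV.
  by rewrite mem_signings.
rewrite mem_signings => /eqP wu ->.
rewrite mem_permutations in hu.
have sz : size w = n.
  by move: (congr1 size wu); rewrite size_map (perm_size hu) size_iota.
(* Entries lie between [1] and [n]; their predecessors undo the shift made by [signed_word]. *)
have lt_entry i : (i < n)%N -> ((nth (0%N, false) w i).1.-1 < n)%N.
  move=> lin; have : (nth (0%N, false) w i).1 \in u.
    by rewrite -wu map_f // mem_nth // sz.
  by rewrite (perm_mem hu) mem_iota; case: (_.1) => [|k] //; rewrite add1n ltnS.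
have entry_gt0 i : (i < n)%N -> (0 < (nth (0%N, false) w i).1)%N.
  move=> lin; have : (nth (0%N, false) w i).1 \in u.
    by rewrite -wu map_f // mem_nth // sz.
  by rewrite (perm_mem hu) mem_iota => /andP[].
pose p (i : 'I_n) := Ordinal (lt_entry i (ltn_ord i)).
have p_inj : injective p.
  move=> i j [] eij; apply/val_inj/eqP => /=.
  have uw : uniq (unzip1 w) by rewrite wu (perm_uniq hu) iota_uniq.
  rewrite -(nth_uniq 0%N _ _ uw) ?size_map ?sz ?ltn_ord //.
  rewrite !(nth_map (0%N, false)) ?sz ?ltn_ord //.
  by rewrite -(prednK (entry_gt0 i _)) // eij prednK // entry_gt0.
exists (perm p_inj, [ffun i : 'I_n => neg w i]); first exact: mem_enum.
apply: (@eq_from_nth _ (0%N, false)).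
  by rewrite size_map size_enum_ord.
move=> i; rewrite sz => lin; rewrite (nth_map (Ordinal lin)) ?size_enum_ord //.
rewrite permE ffunE /= nth_enum_ord // prednK ?entry_gt0 // /neg.
exact: surjective_pairing.
Qed.

Lemma big_signed_perm n (G : seq (nat * bool) -> int) :
  \sum_(s : signed_perm n) G (signed_word s) =
    \sum_(u <- permutations (iota 1 n)) \sum_(v <- signings u) G v.
Proof.
rewrite -big_allpairs_dep -(perm_big _ (perm_signed_words n)) /=.
by rewrite big_image.
Qed.

(** * Sums over permutations *)

(* [\sum_n rising n y x^n / n!] is [(e^x / (2 - e^x))^y]. *)
Fixpoint rising (n : nat) (y : int) : int :=
  if n is n'.+1 then y * (rising n' y + rising n' (y + 1)) else 1.

(** This is [\sum_i 'C(k, i) * a (n + i)]; for [n = 0] it is the coefficient of [x^k / k!] in [e^x]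
    times the exponential generating function of [a]. *)
Fixpoint pascal (a : nat -> int) (k n : nat) : int :=
  if k is k'.+1 then pascal a k' n.+1 + pascal a k' n else a n.

Lemma pascal_shift a k n : pascal (fun i => a i.+1) k n = pascal a k n.+1.
Proof. by elim: k n => //= k IHk n; rewrite !IHk. Qed.

Lemma pascalZD c a b k n :
  pascal (fun i => c * (a i + b i)) k n = c * (pascal a k n + pascal b k n).
Proof. by elim: k n => //= k IHk n; rewrite !IHk; ring. Qed.

(** The sum telescopes by the recurrence of [pascal]; the induction goes down from [i = n.+1], where
    it is empty. *)
Lemma pascal_sum a n i : (i <= n.+1)%N ->
  a n.+1 + \sum_(i <= k < n.+1) pascal a (n - k) k = pascal a (n.+1 - i) i.
Proof.
move=> le_in; rewrite -(subKn le_in); move: (n.+1 - i)%N (leq_subr i n.+1).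
elim=> [|d IHd] led.
  by rewrite subn0 big_geq // addr0 subnn.
rewrite big_ltn ?subSS; last by rewrite ltnS leq_subr.
rewrite -(@subSn d n) // addrCA IHd ?(ltnW led) //.
have -> : (n - (n - d) = d)%N by rewrite subKn.
have -> : (n.+1 - (n - d) = d.+1)%N by rewrite subSn ?leq_subr // subKn.
by rewrite subKn ?(ltnW led) //= subSn // addrC.
Qed.

Lemma pascal_rising1 n y :
  pascal (rising^~ y) n 1
    = y * (pascal (rising^~ y) n 0 + pascal (rising^~ (y + 1)) n 0).
Proof. by rewrite -pascal_shift -pascalZD. Qed.

(* The coefficientwise form of [(2 - e^x) A^(y+1) = e^x A^y], [A = e^x / (2 - e^x)]. *)
Lemma pascal_rising n y :
  pascal (rising^~ y) n 0 + pascal (rising^~ (y + 1)) n 0 = 2 * rising n (y + 1).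
Proof.
elim: n y => [|n IHn] y //=.
by rewrite !pascal_rising1 !IHn -addrACA IHn; ring.
Qed.

(** This matches the classification by the rank of the first letter: the minimum gives the first
    term, with [t + 1 = 2 * y], and rank [k] gives the term of index [k]. *)
Lemma rising_pascal n y :
  rising n.+1 y = 2 * y * rising n y
    + \sum_(1 <= k < n.+1) pascal (rising^~ y) (n - k) k.
Proof.
(* The added copy of [rising n.+1 y] is the term that [pascal_sum] at [i = 1] needs to collapse the
   sum. *)
apply: (@addrI _ (rising n.+1 y)).
rewrite addrCA pascal_sum // subSS subn0 pascal_rising1 pascal_rising /=; ring.
Qed.

Lemma big_permutations_cons (G : seq nat -> int) (L : seq nat) :
  uniq L -> L != [::] ->
  \sum_(u <- permutations L) G u =
    \sum_(a <- L) \sum_(u <- permutations (rem a L)) G (a :: u).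
Proof.
move=> uL L0.
rewrite -(@big_allpairs_dep _ _ _ _ _ _ (fun a u => a :: u) _ _ G).
apply: perm_big.
apply: uniq_perm; first exact: permutations_uniq.
  apply: allpairs_uniq_dep => // [a _|]; first exact: permutations_uniq.
  by move=> [a u] [b v] _ _ /= [-> ->].
move=> u; apply/idP/allpairsPdep => [|[a [v [aL]]]].
  rewrite mem_permutations; case: u => [|a u] pe.
    by rewrite -size_eq0 -(perm_size pe) in L0.
  have aL : a \in L by rewrite -(perm_mem pe) mem_head.
  exists a, u; split=> //; rewrite mem_permutations -(perm_cons a).
  exact: perm_trans pe (perm_to_rem aL).
rewrite !mem_permutations => pe ->.
by rewrite perm_sym (permPl (perm_to_rem aL)) perm_cons perm_sym.
Qed.

Section WeightSums.

Variable y : int.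
Let t := 2 * y - 1.

(** Both claims are proved together. After a first letter of rank [i > 0], the second letters of
    rank at least [i] among the rest are ascents and count twice: this is the total for the rest
    plus a partial sum over ranks, which [pascal_sum] evaluates. *)
Lemma weight_first_sum n L : sorted ltn L -> size L = n.+1 ->
  (forall i, (0 < i <= n)%N ->
     \sum_(u <- permutations (rem (nth 0%N L i) L)) weight t (nth 0%N L i :: u)
       = pascal (rising^~ y) (n - i) i)
  /\ \sum_(u <- permutations L) weight t u = rising n.+1 y.
Proof.
have srt_nth M i j : sorted ltn M -> (i < j < size M)%N ->
    (nth 0 M i < nth 0 M j)%N.
  move=> sM /andP[ij jM]; apply: (sorted_ltn_nth ltn_trans) => //.
  by rewrite inE (ltn_trans ij).
elim: n L => [|n IHn] L sL szL.
  split=> [[]//|]; case: L szL {sL} => [|a []] //= _.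
  rewrite (_ : permutations [:: a] = [:: [:: a]]) // big_seq1 /= /t; ring.
have uL : uniq L by apply: sorted_uniq sL; [exact: ltn_trans | exact: ltnn].
have L0 : L != [::] by rewrite -size_eq0 szL.
have sub i : (i < n.+2)%N -> let M := rem (nth 0%N L i) L in
    sorted ltn M /\ size M = n.+1.
  move=> li; split; last by rewrite size_rem ?szL // mem_nth ?szL.
  exact: (subseq_sorted ltn_trans (rem_subseq _ _)).
have first i : (0 < i <= n.+1)%N ->
    \sum_(u <- permutations (rem (nth 0%N L i) L)) weight t (nth 0%N L i :: u)
      = pascal (rising^~ y) (n.+1 - i) i.
  move=> /andP[i0 li]; have [sM szM] := sub i li.
  set a := nth 0%N L i in sM szM *; set M := rem a L in sM szM *.
  have nthM k : nth 0%N M k = if (k < i)%N then nth 0%N L k else nth 0%N L k.+1.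
    rewrite /M remE index_uniq ?szL // nth_cat size_take szL ltnS li.
    by case: ltnP => ki; rewrite ?nth_take ?nth_drop // addSn subnKC.
  have lt_aM k : (k < n.+1)%N -> (a < nth 0 M k)%N = (i <= k)%N.
    move=> kn; rewrite nthM; case: (ltnP k i) => ki.
      by apply/negbTE; rewrite -leqNgt ltnW // srt_nth // ki szL.
    by rewrite srt_nth // ltnS ki szL.
  have [IH1 IH2] := IHn M sM szM.
  have uM : uniq M by rewrite rem_uniq.
  have M0 : M != [::] by rewrite -size_eq0 szM.
  (* As [i > 0], the least letter of [L] is still in [M], so [a] is not a minimum. *)
  have aN u : perm_eq u M -> all (leq a) u = false.
    move=> pe; rewrite (perm_all _ pe); apply/negbTE/allPn; exists (nth 0%N M 0).
      by rewrite mem_nth ?szM.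
    by rewrite nthM i0 -ltnNge srt_nth // i0 szL.
  rewrite big_permutations_cons // -pascal_sum //; cbv beta; rewrite -IH2.
  rewrite [in RHS]big_permutations_cons // !(@big_nth _ _ _ _ 0%N M) szM.
  rewrite (big_nat_widenl i 0) // [X in _ + X]big_mkcond -big_split /=.
  apply: eq_big_nat => k /andP[_ kn].
  transitivity ((if (i <= k)%N then 2 else 1) *
     \sum_(u <- permutations (rem (nth 0%N M k) M)) weight t (nth 0%N M k :: u)).
    rewrite mulr_sumr !big_seq; apply: eq_bigr => u; rewrite mem_permutations => pe.
    have Mk : nth 0%N M k \in M by rewrite mem_nth ?szM.
    have pe' : perm_eq (nth 0%N M k :: u) M.
      by rewrite (permPr (perm_to_rem Mk)) perm_cons.
    by rewrite -[LHS]/(weight t (a :: nth 0%N M k :: u)) weight_cons aN //= lt_aM.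
  case: leqP => ik /=; last by rewrite mul1r addr0.
  by rewrite IH1 ?(leq_trans i0 ik) // mulr_natl mulr2n.
split=> //; rewrite big_permutations_cons // (big_nth 0%N) szL big_ltn //.
rewrite rising_pascal; congr (_ + _); last first.
  by apply: eq_big_nat => i /andP[i0 li]; rewrite first // i0.
(* Rank [0]: the first letter is the minimum and contributes [t + 1 = 2 * y]. *)
have [sM szM] := sub 0%N isT; have [_ <-] := IHn _ sM szM.
rewrite mulr_sumr !big_seq; apply: eq_bigr => u; rewrite mem_permutations => pe.
rewrite /= (perm_all _ pe) ifT /t; first by rewrite subrK.
apply/allP => b /mem_rem /(nthP 0%N)[[|j] lj <- //].
by rewrite ltnW // srt_nth.
Qed.

Lemma weight_sum L : sorted ltn L ->
  \sum_(u <- permutations L) weight t u = rising (size L) y.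
Proof.
case: L => [|a L] sL; last by have [] := weight_first_sum (size L) _ sL erefl.
by rewrite (_ : permutations [::] = [:: [::]]) // big_seq1.
Qed.

Lemma threshold_sum n : (2 <= n)%N ->
  \sum_(s : signed_perm n | is_threshold s) t ^+ num_odd_cycles s
    = rising n y - n%:R * rising n.-1 y.
Proof.
move=> n2; have siota : sorted ltn (iota 1 n) by exact: iota_ltn_sorted.
have uiota := iota_uniq 1 n.
have iota0 : iota 1 n != [::] by rewrite -size_eq0 size_iota; case: n n2 {siota uiota}.
rewrite big_mkcond /=; under eq_bigr do rewrite is_thresholdE.
rewrite (big_signed_perm n (fun v => if threshold_word v then t ^+ odd_cycles v else 0)).
transitivity (\sum_(a <- iota 1 n) \sum_(u <- permutations (rem a (iota 1 n)))
    (weight t (a :: u) - weight t u)).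
  rewrite big_permutations_cons // !big_seq; apply: eq_bigr => a ain.
  rewrite !big_seq; apply: eq_bigr => u; rewrite mem_permutations => pe.
  have pe' : perm_eq (a :: u) (iota 1 n).
    by rewrite (permPr (perm_to_rem ain)) perm_cons.
  rewrite -weight_threshold_signings ?[RHS]big_mkcond //.
  - by rewrite (perm_uniq pe').
  - rewrite -size_eq0 (perm_size pe) size_rem // size_iota.
    by case: n n2 {siota uiota iota0 ain pe pe'} => [|[]].
  have a_gt0 : (0 < a)%N by move: ain; rewrite mem_iota => /andP[].
  apply/eqP/idP => [->|amin].
    apply/allP => b bu; have : b \in iota 1 n by rewrite -(perm_mem pe') inE bu orbT.
    by rewrite mem_iota => /andP[].
  apply/eqP; rewrite eqn_leq a_gt0 andbT.
  have : 1%N \in a :: u by rewrite (perm_mem pe') mem_iota /= add1n ltnS ltnW.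
  by rewrite inE => /orP[/eqP <- //|/(allP amin)].
rewrite (eq_bigr (fun a => \sum_(u <- permutations (rem a (iota 1 n))) weight t (a :: u)
  - \sum_(u <- permutations (rem a (iota 1 n))) weight t u)); last first.
  by move=> a _; rewrite sumrB.
(* The subtracted weights ignore the first letter, so each of its [n] values contributes
   [rising n.-1 y]. *)
rewrite sumrB -big_permutations_cons // weight_sum // size_iota; congr (_ - _).
rewrite big_seq (eq_bigr (fun=> rising n.-1 y)); last first.
  move=> a ain; rewrite weight_sum ?size_rem ?size_iota //.
  exact: (subseq_sorted ltn_trans (rem_subseq _ _)).
by rewrite -big_seq big_const_seq count_predT size_iota iter_addr_0 mulr_natl.
Qed.

End WeightSums.

(** * Words without antipodal letters *)

(* The number of words of length [n] without antipodal letters, over an alphabet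
   made of [m] antipodal pairs and [s] letters whose antipode is missing. *)
Fixpoint avoiders (n m s : nat) : nat :=
  if n is n'.+1 then s * avoiders n' m s + 2 * m * avoiders n' m.-1 s.+1 else 1.

(** Inclusion-exclusion on one of [m.+1] pairs: a word without antipodal letters omits one letter of
    that pair or the other, and the words omitting both are counted twice. *)
Lemma avoiders_half n m s :
  (2 * avoiders n m s.+1 = avoiders n m.+1 s + avoiders n m s)%N.
Proof.
elim: n m s => //= n IHn [|m] s; first by have := IHn 0%N s; nia.
have := congr1 (muln s) (IHn m.+1 s).
by have := congr1 (muln (2 * m.+1)) (IHn m s.+1); rewrite succnK; nia.
Qed.

(** With [s = 0] only paired letters can come first, and [avoiders_half] turns the resulting [s = 1]
    back into [s = 0]: this is the recurrence of [rising] at a negative argument. *)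
Lemma rising_opp n m : rising n (- m%:Z) = (-1) ^+ n * (avoiders n m 0)%:Z.
Proof.
elim: n m => // n IHn [|m].
  by rewrite /= muln0 !mul0n oppr0 mul0r mulr0.
rewrite [LHS]/= [avoiders _ _ _]/= mul0n add0n.
have -> : - m.+1%:Z + 1 = - m%:Z by lia.
rewrite !IHn mulnAC avoiders_half exprS PoszM PoszD; ring.
Qed.

Section Antipodes.

Variables (T : finType) (opp : T -> T).
Hypothesis oppK : involutive opp.

Definition pair_free (w : seq T) := pairwise (fun a b => b != opp a) w.

Fixpoint words (n : nat) : seq (seq T) :=
  if n is n'.+1 then [seq a :: w | a <- enum T, w <- words n'] else [:: [::]].

Lemma mem_words n w : (w \in words n) = (size w == n).
Proof.
elim: n w => [|n IHn] [|a w] //=; rewrite ?inE //.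
  by apply/negP => /allpairsP[[]] ? ? [].
rewrite eqSS -IHn; apply/allpairsP/idP => [[[b v] /= [_ vn [_ ->]]] //|wn].
by exists (a, w); rewrite /= mem_enum.
Qed.

Lemma uniq_words n : uniq (words n).
Proof.
elim: n => //= n IHn; apply: allpairs_uniq => //; first exact: enum_uniq.
by move=> [a u] [b v] _ _ /= [-> ->].
Qed.

Lemma big_words n (P : pred (seq T)) :
  #|[set f : {ffun 'I_n -> T} | P (codom f)]| = (\sum_(w <- words n | P w) 1)%N.
Proof.
have pe : perm_eq [seq codom f | f : {ffun 'I_n -> T}] (words n).
  apply: uniq_perm; rewrite ?uniq_words //.
    rewrite map_inj_uniq ?enum_uniq // => f g /eq_in_map fg.
    by apply/ffunP => i; apply: fg; rewrite mem_enum.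
  move=> w; rewrite mem_words; apply/mapP/eqP => [[f _ ->]|sw].
    by rewrite size_codom card_ord.
  exists [ffun i => tnth (Tuple (introT eqP sw)) i]; rewrite ?mem_enum //.
  rewrite -[LHS]/(tval (Tuple (introT eqP sw))) -[LHS]map_tnth_enum.
  by apply: eq_map => i; rewrite ffunE.
by rewrite -(perm_big _ pe) big_image_cond -sum1dep_card.
Qed.

Fixpoint count_words (n : nat) (S : {set T}) : nat :=
  if n is n'.+1 then \sum_(a in S) count_words n' (S :\ opp a) else 1.

Lemma count_wordsE n (S : {set T}) :
  (\sum_(w <- words n | all [in S] w && pair_free w) 1)%N = count_words n S.
Proof.
elim: n S => [|n IHn] S; first by rewrite /= big_cons big_nil.
rewrite big_mkcond /= big_allpairs_dep big_enum /= [RHS]big_mkcond.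
apply: eq_bigr => a _; case: ifP => aS; last by rewrite big1.
rewrite -IHn [RHS]big_mkcond; apply: eq_bigr => w _ /=.
rewrite andbA -all_predI; congr (if _ && _ then _ else _).
by apply: eq_all => b /=; rewrite !inE andbC.
Qed.

Definition antipode_missing (S : {set T}) := [set x in S | opp x \notin S].
Definition antipode_paired (S : {set T}) := [set x in S | (opp x \in S) && (opp x != x)].
Definition self_antipodal (S : {set T}) := [set x in S | opp x == x].

(** A self-antipodal letter occurs at most once; if it occurs, it has [n] possible positions and the
    other [n.-1] letters form a word without it. The induction splits on the type of the first
    letter. *)
Lemma count_words_avoiders n (S : {set T}) m s (z : bool) :
  #|antipode_missing S| = s -> #|antipode_paired S| = (2 * m)%N ->
  #|self_antipodal S| = z ->
  count_words n S = (avoiders n m s + z * (n * avoiders n.-1 m s))%N.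
Proof.
elim: n S m s z => [|n IHn] S m s z hs hm hz; first by rewrite /= mul0n muln0.
rewrite /= (bigID (fun a => opp a == a)) /=.
rewrite [X in (_ + X)%N](bigID (fun a => opp a \in S)) /=.
have -> : (\sum_(a in S | opp a == a) count_words n (S :\ opp a)
    = z * avoiders n m s)%N.
  rewrite -hz -sum1dep_card big_distrl /=.
  apply: eq_big => [a|a /andP[aS /eqP fa]]; first by [].
  rewrite mul1n fa (IHn _ m s false) ?mul0n ?addn0 //.
  - rewrite -hs; apply: eq_card => x; rewrite !inE negb_and negbK.
    case: (eqVneq x a) => [->|xa] /=; first by rewrite fa aS andbF.
    by rewrite (inv_eq oppK) fa (negbTE xa).
  - rewrite -hm; apply: eq_card => x; rewrite !inE.
    case: (eqVneq x a) => [->|xa] /=; first by rewrite fa eqxx andbF andbF.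
    by rewrite (inv_eq oppK) fa (negbTE xa).
  apply/eqP; rewrite cards_eq0; apply/eqP/setP => x; rewrite !inE.
  apply/negP => /andP[/andP[xa xS] fx].
  (* A second self-antipodal letter [x] would contradict that there are at most [z <= 1] of them. *)
  have : (#|[set x; a]| <= z)%N.
    rewrite -hz subset_leq_card //; apply/subsetP => b; rewrite !inE.
    by move=> /orP[]/eqP->; rewrite ?xS ?aS ?fx ?fa ?eqxx.
  by rewrite cards2 xa; case: (z).
have -> : (\sum_(a | (a \in S) && (opp a != a) && (opp a \in S))
      count_words n (S :\ opp a)
    = 2 * m * (avoiders n m.-1 s.+1 + z * (n * avoiders n.-1 m.-1 s.+1)))%N.
  rewrite -hm -sum1dep_card big_distrl /=.
  apply: eq_big => [a|a]; first by rewrite -andbA [(_ != _) && _]andbC.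
  move=> /andP[/andP[aS fa] oS].
  rewrite mul1n (IHn _ m.-1 s.+1 z) //.
  - rewrite (_ : antipode_missing _ = a |: antipode_missing S).
      by rewrite cardsU1 hs inE aS oS.
    apply/setP => x; rewrite !inE negb_and negbK (inj_eq (inv_inj oppK)).
    case: (eqVneq x a) => [->|] //=; rewrite ?aS ?andbT 1?eq_sym //.
    by case: (eqVneq x (opp a)) => //= ->; rewrite oppK aS andbF.
  - have -> : antipode_paired (S :\ opp a) = antipode_paired S :\ a :\ opp a.
      apply/setP => x; rewrite !inE (inj_eq (inv_inj oppK)).
      by case: (x == a); case: (x == opp a); rewrite /= ?andbF.
    have := hm; rewrite (cardsD1 a) (cardsD1 (opp a)) !inE aS oS fa oppK aS.
    by rewrite eq_sym fa /=; lia.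
  rewrite -hz; apply: eq_card => x; rewrite !inE.
  case: (eqVneq x (opp a)) => [->|] //=.
  by rewrite oppK oS eq_sym (negbTE fa).
(* Here removing [opp a] leaves the alphabet unchanged. *)
have -> : (\sum_(a | (a \in S) && (opp a != a) && (opp a \notin S))
      count_words n (S :\ opp a)
    = s * (avoiders n m s + z * (n * avoiders n.-1 m s)))%N.
  rewrite -{1}hs -sum1dep_card big_distrl /=.
  apply: eq_big => [a|a /andP[/andP[aS fa] oS]].
    rewrite -andbA; case: (boolP (a \in S)) => //= aS.
    by case: (eqVneq (opp a) a) => [->|]; rewrite ?aS.
  rewrite mul1n -(IHn S m s z) //; congr count_words.
  by apply/setP => x; rewrite !inE; case: eqVneq => // ->; rewrite (negbTE oS).
by case: n {IHn} => [|n] /=; nia.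
Qed.

End Antipodes.

Lemma card_pair_free n m :
  #|[set f : {ffun 'I_n -> 'I_(2 * m).+1} | pair_free _ (@rev_ord _) (codom f)]|
    = (avoiders n m 0 + n * avoiders n.-1 m 0)%N.
Proof.
rewrite big_words.
have rK : involutive (@rev_ord (2 * m).+1) by exact: rev_ordK.
(* The one self-antipodal letter, which stands for the coordinate [0]. *)
pose mid := @inord (2 * m) m.
have fixE x : (rev_ord x == x :> 'I_(2 * m).+1) = (x == mid).
  by rewrite -!val_eqE /= inordK //; lia.
rewrite (eq_bigl (fun w => all [in [set: 'I_(2 * m).+1]] w
   && pair_free _ (@rev_ord _) w)); last first.
  move=> w; rewrite (_ : all _ w = true) //.
  by apply/allP => x _; rewrite inE.
rewrite count_wordsE (count_words_avoiders _ _ rK n _ m 0 true) ?mul1n //.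
- by apply/eqP; rewrite cards_eq0; apply/eqP/setP => x; rewrite !inE.
- rewrite (_ : antipode_paired _ _ _ = [set~ mid]).
    by rewrite cardsC1 card_ord.
  by apply/setP => x; rewrite !inE fixE.
rewrite (_ : self_antipodal _ _ _ = [set mid]) ?cards1 //.
by apply/setP => x; rewrite !inE fixE.
Qed.

(** * Counting points on flats *)

(** As [x] is the minimum of [P], the interval from [x] to [y] is everything below [y], and this is
    the recurrence [mobiusE] rearranged. *)
Lemma mobius_sum (T : choiceType) (le : rel T) (P : {fset T}) (x y : T) :
  reflexive le -> transitive le -> antisymmetric le ->
  (forall z, z \in P -> le x z) -> y \in P ->
  \sum_(z <- P | le z y) mobius le P x z = (x == y)%:R.
Proof.
move=> lexx le_tr le_anti x_min yP.
rewrite big_mkcond (bigD1_seq y) ?fset_uniq //= lexx.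
rewrite mobiusE // [_ == y]eq_sym; have [->|nyx] := eqVneq y x.
  rewrite big1_seq ?addr0 // => z /andP[nzx zP]; case: ifP => // zx.
  by case/eqP: nzx; apply: le_anti; rewrite zx x_min.
apply/eqP; rewrite addrC subr_eq0 -big_mkcondr; apply/eqP.
rewrite big_seq_cond [RHS]big_seq_cond; apply: eq_bigl => z.
by case: (boolP (z \in P)) => //= zP; rewrite x_min //= andbC.
Qed.

Lemma mem_bigcapv (F : fieldType) (vT : vectType F) (x : vT) (s : seq {vspace vT}) :
  (x \in (\bigcap_(H <- s) H)%VS) = all (fun H : {vspace vT} => x \in H) s.
Proof.
elim: s => [|H s IHs]; first by rewrite big_nil memvf.
by rewrite big_cons memv_cap IHs.
Qed.

Lemma intersection_posetP (F : fieldType) (n : nat) (A : arrangement F n) X :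
  reflect (exists2 B : arrangement F n, (B `<=` A)%fset & X = (\bigcap_(H <- B) H)%VS)
    (X \in intersection_poset A).
Proof.
apply: (iffP (imfsetP _ _ _ _)) => [[B /=]|[B BA ->]].
  by rewrite fpowersetE => BA ->; exists B.
by exists B => //=; rewrite fpowersetE.
Qed.

(* The finite field method: a finite set of points meeting every flat [X] in
   [q ^ dim X] points plays the role of the points over the field with [q]
   elements. *)
Lemma char_poly_points (F : fieldType) (n : nat) (A : arrangement F n)
    (I : finType) (pt : I -> 'rV[F]_n) (q : nat) :
  (forall X, X \in intersection_poset A ->
     #|[set i | pt i \in X]| = (q ^ \dim X)%N) ->
  (forall H, H \in A -> H != fullv) ->
  (arr_char_poly A).[q%:Z]
    = (#|[set i | all (fun H : {vspace _} => pt i \notin H) A]|)%:Z.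
Proof.
move=> ptX properA; set L := intersection_poset A in ptX *.
have le_refl : reflexive (@reverse_inclusion F n) by move=> X; apply: subvv.
have le_tr : transitive (@reverse_inclusion F n).
  by move=> Y X Z YX ZY; apply: subv_trans ZY YX.
have le_anti : antisymmetric (@reverse_inclusion F n).
  move=> X Y /andP[YX XY]; apply: subv_anti.
  by apply/andP; split; [apply: XY | apply: YX].
have full_min Z : Z \in L -> reverse_inclusion fullv Z by move=> _; apply: subvf.
rewrite /arr_char_poly horner_sum -/L.
transitivity (\sum_(X <- L) \sum_(i : I)
    if pt i \in X then mobius (@reverse_inclusion F n) L fullv X else 0).
  rewrite !big_seq; apply: eq_bigr => X XL.
  rewrite hornerZ hornerXn -big_mkcond sumr_const -mulr_natr; congr (_ * _).
  by rewrite -[q%:Z]natz -natrX -ptX // cardsE.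
rewrite exchange_big /= -sum1dep_card.
rewrite -[RHS]natz natr_sum [RHS]big_mkcond; apply: eq_bigr => i _.
(* [Y] is the smallest flat through the point: the flats containing the point are those containing
   [Y], so its contribution is a Möbius sum up to [Y]. *)
pose B := [fset H in A | pt i \in H]%fset.
pose Y : {vspace 'rV[F]_n} := (\bigcap_(H <- B) H)%VS.
have YL : Y \in L.
  apply/intersection_posetP; exists B => //; apply/fsubsetP => H.
  by rewrite !inE => /andP[].
have YE X : X \in L -> (pt i \in X) = reverse_inclusion X Y.
  move=> /intersection_posetP[C CA ->]; apply/idP/subvP => [|sub]; last first.
    apply: sub; rewrite mem_bigcapv; apply/allP => H.
    by rewrite !inE => /andP[].
  rewrite mem_bigcapv => /allP piC x; rewrite !mem_bigcapv => /allP xB.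
  apply/allP => H HC; apply: xB.
  by rewrite !inE (fsubsetP CA) //= piC.
rewrite -big_mkcond big_seq_cond.
rewrite (eq_bigl (fun X => (X \in L) && reverse_inclusion X Y)); last first.
  by move=> X; case: (boolP (X \in L)) => //= /YE.
rewrite -big_seq_cond mobius_sum //.
suff -> : (fullv == Y) = all (fun H : {vspace _} => pt i \notin H) A by case: all.
apply/eqP/allP => [fY H HA|piA].
  apply/negP => piH; have /negP := properA H HA; apply.
  apply/eqP/vspaceP => x; rewrite memvf; have := memvf x; rewrite fY mem_bigcapv.
  by move=> /allP; apply; rewrite !inE HA.
apply/vspaceP => x; rewrite memvf mem_bigcapv; apply/esym/allP => H.
by rewrite !inE => /andP[/= /piA/negbTE ->].
Qed.

(** * Flats of the threshold arrangement, parametrized by free coordinates *)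

Section Flats.

Variables (R : realFieldType) (n : nat).

(* [X] is parametrized by the coordinates in [D]. *)
Definition signed_flat (X : {vspace 'rV[R]_n}) (D : {set 'I_n})
    (r : 'I_n -> 'I_n) (e : 'I_n -> R) :=
  [/\ {in D, forall i, r i = i /\ e i = 1},
      (forall i, e i \in [:: 0; 1; -1]),
      (forall i, e i != 0 -> r i \in D)
    & (forall x, x \in X <-> forall i, x 0 i = e i * x 0 (r i))].

Lemma signed_flat_fullv : signed_flat fullv setT id (fun=> 1).
Proof.
split=> // [i|i _|x]; rewrite ?inE ?eqxx ?orbT //.
by split=> _; rewrite ?memvf // => i; rewrite mul1r.
Qed.

Lemma signed_flat_sub (X Y : {vspace _}) D r e : signed_flat X D r e ->
  (forall x, x \in X -> x \in Y) -> signed_flat (X :&: Y)%VS D r e.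
Proof.
move=> [h1 h2 h3 h4] XY; split=> // x; rewrite memv_cap; split.
  by case/andP => /h4.
by move=> /h4 xX; rewrite xX XY.
Qed.

Lemma signed_flat_impose (X Y : {vspace _}) D r e c d (k : R) :
  signed_flat X D r e -> c \in D -> d \in D -> k \in [:: 0; 1; -1] ->
  (k != 0 -> d != c) ->
  (forall x, x \in X -> (x \in Y) = (x 0 c == k * x 0 d)) ->
  signed_flat (X :&: Y)%VS (D :\ c) (fun i => if r i == c then d else r i)
    (fun i => if r i == c then e i * k else e i).
Proof.
move=> [h1 h2 h3 h4] cD dD hk dc XY; split=> [i|i|i|x].
- by rewrite !inE => /andP[ic /h1[-> ->]]; rewrite (negbTE ic).
- case: ifP => _ //; have := h2 i; move: hk; rewrite !inE.
  by do 2!case/or3P=> /eqP->;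
    rewrite ?mul0r ?mulr0 ?mul1r ?mulrN1 ?opprK ?mulr1 ?eqxx ?orbT.
- case: ifPn => [_|ric] ei0; rewrite !inE ?ric ?h3 //.
  by rewrite mulf_eq0 negb_or in ei0; rewrite dc ?dD //; case/andP: ei0.
rewrite memv_cap; split.
  move=> /andP[xX]; rewrite XY // => /eqP xc i.
  have := xX; rewrite h4 => /(_ i) ->; case: eqP => // ->.
  by rewrite xc mulrA.
move=> hx; have [rc ec] := h1 c cD.
have xc : x 0 c = k * x 0 d by rewrite hx rc eqxx ec mul1r.
have xX : x \in X.
  apply/h4 => i; rewrite hx; case: eqP => // ->.
  by rewrite xc mulrA.
by rewrite xX XY // xc eqxx.
Qed.

(** In free coordinates the equation has at most two terms: it is trivial, makes one coordinate
    vanish, or identifies two coordinates up to sign. *)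
Lemma signed_flat_cap X D r e a b : signed_flat X D r e ->
  exists D' r' e', signed_flat (X :&: sum_hyperplane R a b)%VS D' r' e'.
Proof.
move=> fX; have [h1 h2 h3 h4] := fX.
have XH x : x \in X ->
    (x \in sum_hyperplane R a b) = (e a * x 0 (r a) + e b * x 0 (r b) == 0).
  by rewrite mem_sum_hyperplane => /h4 hx; rewrite [in LHS]hx [x 0 b]hx.
have kill c : c \in D ->
    (forall x, x \in X -> (x \in sum_hyperplane R a b) = (x 0 c == 0)) ->
    exists D' r' e', signed_flat (X :&: sum_hyperplane R a b)%VS D' r' e'.
  move=> cD hc; do 3!eexists; apply: (signed_flat_impose _ _ _ _ _ c c 0 fX) => //.
  - by rewrite !inE eqxx.
  - by rewrite eqxx.
  by move=> x /hc ->; rewrite mul0r.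
have [ea0|ea0] := eqVneq (e a) 0; have [eb0|eb0] := eqVneq (e b) 0.
- exists D, r, e; apply: signed_flat_sub => // x /XH ->.
  by rewrite ea0 eb0 !mul0r addr0.
- apply: (kill (r b)) => [|x /XH ->]; first exact: h3.
  by rewrite ea0 mul0r add0r mulf_eq0 (negbTE eb0).
- apply: (kill (r a)) => [|x /XH ->]; first exact: h3.
  by rewrite eb0 mul0r addr0 mulf_eq0 (negbTE ea0).
have [rab|rab] := eqVneq (r a) (r b).
  have [eab|eab] := eqVneq (e a + e b) 0.
    exists D, r, e; apply: signed_flat_sub => // x /XH ->.
    by rewrite rab -mulrDl eab mul0r.
  apply: (kill (r b)) => [|x /XH ->]; first exact: h3.
  by rewrite rab -mulrDl mulf_eq0 (negbTE eab).
have sgn i : e i != 0 -> e i = 1 \/ e i = -1.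
  have := h2 i; rewrite !inE => /or3P[]/eqP->; rewrite ?eqxx //; [left|right] => //.
(* Solving for the coordinate [r b] divides by [e b], which is its own inverse. *)
do 3!eexists; apply: (signed_flat_impose _ _ _ _ _ (r b) (r a) (- (e a * e b)) fX).
- exact: h3.
- exact: h3.
- by case: (sgn a ea0) => ->; case: (sgn b eb0) => ->;
    rewrite ?mulr1 ?mul1r ?mulrN1 ?opprK !inE eqxx ?orbT.
- by [].
move=> x /XH ->; rewrite -[in RHS]subr_eq0; case: (sgn b eb0) => ->.
  by congr (_ == 0); ring.
by rewrite -[in RHS]oppr_eq0; congr (_ == 0); ring.
Qed.

Lemma threshold_flat X : X \in intersection_poset (threshold_arrangement R n) ->
  exists D r e, signed_flat X D r e.
Proof.
case/intersection_posetP => B /fsubsetP BA ->.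
have {BA} : {subset enum_fset B <= threshold_arrangement R n} by [].
elim: (enum_fset B) => [|H s IHs] sA.
  by rewrite big_nil; do 3!eexists; apply: signed_flat_fullv.
have [|D [r [e fs]]] := IHs; first by move=> K Ks; apply: sA; rewrite inE Ks orbT.
have /imfsetP[[a b] _ ->] := sA H (mem_head _ _).
by rewrite big_cons capvC; apply: signed_flat_cap fs.
Qed.

(** The projection [f] to the coordinates in [D] is an isomorphism on [X]. *)
Lemma dim_signed_flat X D r e : signed_flat X D r e -> \dim X = #|D|.
Proof.
move=> [h1 h2 h3 h4].
pose f : {linear 'rV[R]_n -> 'rV[R]_#|D|} := mxsub id (@enum_val _ (mem D)).
have fE x j : linfun f x 0 j = x 0 (enum_val j) by rewrite lfunE mxE.
rewrite -(@limg_dim_eq _ _ _ (linfun f) X).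
  suff -> : (linfun f @: X)%VS = fullv by rewrite dimvf dim_matrix mul1r.
  apply/vspaceP => v; rewrite memvf; apply/memv_imgP.
  (* The entry of [v] indexed by [r i], or [0] when [r i] is not in [D]. *)
  pose g i := \sum_j v 0 j *+ (enum_val j == r i :> 'I_n).
  have xD i : i \in D -> r i = i /\ e i = 1 by exact: h1.
  exists (\row_i (e i * g i)).
    apply/h4 => i; rewrite !mxE; have [->|ei0] := eqVneq (e i) 0.
      by rewrite !mul0r.
    by have [rri ->] := xD _ (h3 i ei0); rewrite /g rri mul1r.
  apply/rowP => j; rewrite fE mxE /g.
  have [-> ->] := xD _ (enum_valP j); rewrite mul1r (bigD1 j) //= eqxx.
  rewrite big1 ?addr0 // => k kj.
  by rewrite (inj_eq enum_val_inj) (negbTE kj).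
apply/eqP; rewrite -subv0; apply/subvP => x; rewrite memv_cap memv0.
case/andP=> /h4 hx; rewrite memv_ker => /eqP fx; apply/eqP/rowP => i.
rewrite mxE hx; have [->|ei0] := eqVneq (e i) 0; first by rewrite mul0r.
have := fE x (enum_rank_in (h3 i ei0) (r i)).
by rewrite fx enum_rankK_in ?h3 // mxE => <-; rewrite mulr0.
Qed.

(** * Points of the grid on flats *)

Variable m : nat.

Definition centered (k : 'I_(2 * m).+1) : R := (k : nat)%:R - m%:R.

Lemma centered_inj : injective centered.
Proof. by move=> k l /addIr /eqP; rewrite eqr_nat => /eqP/ord_inj. Qed.

Lemma centered_rev k : centered (rev_ord k) = - centered k.
Proof.
rewrite /centered /= subSS natrB; last by rewrite -ltnS.
by rewrite natrM; ring.
Qed.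

Definition lattice_point (f : {ffun 'I_n -> 'I_(2 * m).+1}) : 'rV[R]_n :=
  \row_i centered (f i).

(** The grid is stable under multiplication by [0], [1] and [-1], so the coordinates in [D] are
    chosen freely in it and determine the others. *)
Lemma card_signed_flat X D r e : signed_flat X D r e ->
  #|[set f | lattice_point f \in X]| = ((2 * m).+1 ^ #|D|)%N.
Proof.
move=> [h1 h2 h3 h4]; pose mid := @inord (2 * m) m.
have centered_mid : centered mid = 0.
  by rewrite /centered inordK ?subrr //; lia.
pose act (a : R) k := if a == 0 then mid else if a == 1 then k else rev_ord k.
have actE i k : centered (act (e i) k) = e i * centered k.
  have := h2 i; rewrite /act !inE => /or3P[]/eqP->.
  - by rewrite eqxx mul0r.
  - by rewrite oner_eq0 eqxx mul1r.
  by rewrite oppr_eq0 oner_eq0 -subr_eq0 -opprD oppr_eq0 -mulr2n pnatr_eq0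
    mulN1r centered_rev.
(* A choice of free coordinates is a function with the default value [mid] outside [D]. *)
have -> : ((2 * m).+1 ^ #|D|)%N = #|pffun_on mid D predT|.
  by rewrite card_pffun_on card_ord.
pose ext (g : {ffun 'I_n -> 'I_(2 * m).+1}) := [ffun i => act (e i) (g (r i))].
have extD g i : i \in D -> ext g i = g i.
  by move=> /h1[ri ei]; rewrite ffunE ri ei /act oner_eq0 eqxx.
have ext_inj : {in pffun_on mid D predT &, injective ext}.
  move=> g g' /pffun_onP[/subsetP sg _] /pffun_onP[/subsetP sg' _] eg.
  apply/ffunP => i; case: (boolP (i \in D)) => iD.
    by rewrite -extD // eg extD.
  have [gi g'i] := (contraNeq (sg i) iD, contraNeq (sg' i) iD).
  by rewrite gi g'i.
rewrite -(card_in_imset ext_inj); apply: eq_card => f; rewrite inE.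
apply/idP/imsetP => [/h4 hf|[g _ ->]].
  exists [ffun i => if i \in D then f i else mid].
    apply/pffun_onP; split=> //; apply/subsetP => i; rewrite inE ffunE.
    by case: ifP; rewrite ?eqxx.
  apply/ffunP => i; apply: centered_inj; rewrite ffunE actE ffunE.
  have := hf i; rewrite !mxE => ->; have [->|ei0] := eqVneq (e i) 0.
    by rewrite !mul0r.
  by rewrite h3.
apply/h4 => i; rewrite !mxE [in LHS]ffunE actE.
have [->|ei0] := eqVneq (e i) 0; first by rewrite !mul0r.
by rewrite extD // h3.
Qed.

Lemma lattice_point_pair_free f :
  all (fun H : {vspace _} => lattice_point f \notin H) (threshold_arrangement R n)
    = pair_free _ (@rev_ord _) (codom f).
Proof.
have memH i j : (lattice_point f \in sum_hyperplane R i j) = (f j == rev_ord (f i)).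
  rewrite mem_sum_hyperplane !mxE addrC addr_eq0 -centered_rev.
  exact: (inj_eq centered_inj).
have sz : size (codom f) = n by rewrite size_codom card_ord.
have nthE (i : 'I_n) : nth ord0 (codom f) i = f i.
  by rewrite (nth_map i) ?size_enum_ord // nth_ord_enum.
apply/allP/(pairwiseP ord0) => [hA i j|hp H].
  rewrite !inE sz => li lj ij.
  have := hA (sum_hyperplane R (Ordinal li) (Ordinal lj)).
  rewrite memH -!nthE; apply; apply/imfsetP.
  by exists (Ordinal li, Ordinal lj); rewrite //= inE.
case/imfsetP => [[i j]] /=; rewrite inE /= => ij ->; rewrite memH.
have := hp i j; rewrite !inE sz !ltn_ord => /(_ isT isT ij).
by rewrite !nthE.
Qed.

Lemma sum_hyperplane_proper (i j : 'I_n) : sum_hyperplane R i j != fullv.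
Proof.
apply/negP => /eqP/vspaceP/(_ (const_mx 1)).
by rewrite memvf mem_sum_hyperplane !mxE -mulr2n pnatr_eq0.
Qed.

Lemma threshold_char_poly :
  (arr_char_poly (threshold_arrangement R n)).[(2 * m).+1%:Z]
    = (avoiders n m 0 + n * avoiders n.-1 m 0)%:Z.
Proof.
rewrite (char_poly_points _ _ _ _ lattice_point).
- rewrite -card_pair_free; congr Posz; apply: eq_card => f.
  by rewrite !inE lattice_point_pair_free.
- move=> X /threshold_flat[D [r [e fX]]].
  by rewrite (card_signed_flat _ _ _ _ fX) (dim_signed_flat _ _ _ _ fX).
by move=> H /imfsetP[p _ ->]; apply: sum_hyperplane_proper.
Qed.

End Flats.

(** * Comparison of the two polynomials *)

Lemma poly_eq_odd (p q : {poly int}) :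
  (forall m : nat, p.[(2 * m).+1%:Z] = q.[(2 * m).+1%:Z]) -> p = q.
Proof.
move=> pq; apply/eqP; rewrite -subr_eq0; apply/negPn/negP => nz.
have := @max_poly_roots _ _ [seq (2 * m).+1%:Z | m <- iota 0 (size (p - q))] nz.
rewrite size_map size_iota ltnn => h; suff : false by [].
apply: h.
  by apply/allP => _ /mapP[m _ ->]; rewrite rootE hornerD hornerN pq subrr.
by rewrite map_inj_uniq ?iota_uniq // => a b []; lia.
Qed.

Theorem theorem4p4 (R : realType) (n j : nat) (hn : (2 <= n)%N) (hj : (j <= n)%N) :
  `|(arr_char_poly (threshold_arrangement R n))`_j|
    = (#|[set s : signed_perm n | is_threshold s && (num_odd_cycles s == j)]|)%:Z.
Proof.
(* This is [(-1)^n T_n(-t)]; at [t = 2m + 1] it calls for [threshold_sum] with [y = -m]. *)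
pose Q : {poly int} := (-1) ^+ n *:
  \sum_(s : signed_perm n | is_threshold s)
    (-1) ^+ num_odd_cycles s *: 'X^(num_odd_cycles s).
have -> : arr_char_poly (threshold_arrangement R n) = Q.
  apply: poly_eq_odd => m; rewrite threshold_char_poly hornerZ horner_sum.
  rewrite (eq_bigr (fun s => (2 * (- m%:Z) - 1) ^+ num_odd_cycles s)); last first.
    move=> s _; rewrite hornerZ hornerXn -exprMn; congr (_ ^+ _); lia.
  rewrite threshold_sum // !rising_opp.
  case: n hn {hj Q} => // n _; rewrite succnK exprS PoszD PoszM natz.
  rewrite -[LHS]mul1r -[X in X * _ = _](sqrr_sign _ n); ring.
rewrite /Q coefZ coef_sum normrM normrX normrN1 expr1n mul1r.
(* All terms in degree [j] carry the same sign, so nothing cancels and the absolute value counts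
   them. *)
rewrite (eq_bigr (fun s => if num_odd_cycles s == j then (-1) ^+ j else 0)); last first.
  move=> s _; rewrite coefZ coefXn eq_sym; case: eqP => [->|_].
    by rewrite mulr1.
  by rewrite mulr0.
rewrite -big_mkcondr sumr_const normrMn normrX normrN1 expr1n natz.
by congr Posz; rewrite cardsE.
Qed.
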